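(* Let $G$ be a connected $\{P_6,C_5,K_{1,3}\}$-free graph which contains an induced $C_6$. Then $V(G)$ can be partitioned into sets $A_0,A_1,\dots,A_5,B_0,B_1,B_2$, with each $A_i$ nonempty and each $B_j$ possibly empty, such that two distinct vertices of $G$ are adjacent if and only if one of the following holds: (i) they both lie in the same set $A_i$ or both lie in the same set $B_j$ (so each of these sets induces a complete graph); (ii) one lies in $A_i$ and the other in $A_{i+1}$ for some $i\in\{0,\dots,5\}$, indices modulo $6$; (iii) one lies in $A_i$ and the other in $B_j$ for some $i\in\{0,\dots,5\}$, $j\in\{0,1,2\}$ with $i\not\equiv j \pmod 3$.
   Context: All graphs are finite, simple and undirected. $P_n$ and $C_n$ denote the path and cycle on $n$ vertices, and $K_{1,3}$ is the claw. A graph is $\mathcal{F}$-free if it has no induced subgraph isomorphic to a member of $\mathcal{F}$. *)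

(* Defs.v *)
From Stdlib Require List.
From mathcomp Require Import all_boot.
Set Implicit Arguments.
Unset Strict Implicit.
Unset Printing Implicit Defensive.

Record sgraph := SGraph {
  vertex :> finType;
  adj : rel vertex;
  adj_sym : symmetric adj;
  adj_irrefl : irreflexive adj
}.

Definition connected_graph (G : sgraph) : Prop :=
  forall x y : G, connect (@adj G) x y.

Definition induced_subgraph (H G : sgraph) : Prop :=
  exists f : H -> G, injective f /\ forall x y : H, adj (f x) (f y) = adj x y.

Definition free (F : seq sgraph) (G : sgraph) : Prop :=
  forall H : sgraph, List.In H F -> ~ induced_subgraph H G.

Definition path_adj n : rel 'I_n :=
  fun i j => (j == i.+1 :> nat) || (i == j.+1 :> nat).

Lemma path_adj_sym n : symmetric (@path_adj n).
Proof. by move=> i j; rewrite /path_adj orbC. Qed.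

Lemma path_adj_irrefl n : irreflexive (@path_adj n).
Proof. by move=> i; rewrite /path_adj orbb ltn_eqF. Qed.

Definition path_graph n : sgraph :=
  SGraph (@path_adj_sym n) (@path_adj_irrefl n).

(* The conjunct i != j only matters for n = 1, where ordS i = i. *)
Definition cycle_adj n : rel 'I_n :=
  fun i j => (i != j) && ((j == ordS i) || (i == ordS j)).

Lemma cycle_adj_sym n : symmetric (@cycle_adj n).
Proof. by move=> i j; rewrite /cycle_adj eq_sym orbC. Qed.

Lemma cycle_adj_irrefl n : irreflexive (@cycle_adj n).
Proof. by move=> i; rewrite /cycle_adj eqxx. Qed.

(* This is the cycle C_n when n >= 3. *)
Definition cycle_graph n : sgraph :=
  SGraph (@cycle_adj_sym n) (@cycle_adj_irrefl n).

Definition complete_bipartite_adj m n : rel ('I_m + 'I_n)%type :=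
  fun u v => match u, v with
             | inl _, inr _ | inr _, inl _ => true
             | _, _ => false
             end.

Lemma complete_bipartite_adj_sym m n : symmetric (@complete_bipartite_adj m n).
Proof. by move=> [i|i] [j|j]. Qed.

Lemma complete_bipartite_adj_irrefl m n :
  irreflexive (@complete_bipartite_adj m n).
Proof. by move=> [i|i]. Qed.

Definition complete_bipartite m n : sgraph :=
  SGraph (@complete_bipartite_adj_sym m n) (@complete_bipartite_adj_irrefl m n).

Definition claw : sgraph := complete_bipartite 1 3.

(* Unlike [partition], this allows empty parts; distinct indices must still
   have disjoint parts. *)
Definition partition_family (T I : finType) (X : I -> {set T}) : Prop :=
  \bigcup_i X i = [set: T] /\ forall i j : I, i != j -> [disjoint X i & X j].

Definition family_sum (T I J : finType) (A : I -> {set T}) (B : J -> {set T}) :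
    (I + J)%type -> {set T} :=
  fun s => match s with inl i => A i | inr j => B j end.

Definition one_in_each (T : finType) (X Y : {set T}) (x y : T) : Prop :=
  (x \in X /\ y \in Y) \/ (x \in Y /\ y \in X).

(* Main.v *)
Require Import Defs.
From mathcomp Require Import all_boot.

Set Implicit Arguments.
Unset Strict Implicit.
Unset Printing Implicit Defensive.

(** Fix an induced hexagon c and record, for each vertex v, which c_k lie in
    its closed neighbourhood.  Claw-, P_6- and C_5-freeness leave ten possible
    0/1 words: the zero word, the words of c_0, ..., c_5, and three words with
    two opposite zeros; these last vertices form the sets B_j.  Any two of the
    ten words differ in at least two places.  A vertex x with the word of c_i
    can replace c_i in the hexagon, and each other vertex y then has one of the
    ten words for the new hexagon too, differing from its old one at most in
    place i; so the words agree, and x is a closed twin of c_i.  The zero word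
    and the adjacencies between the B_j are settled by claws. *)

(** * Bounded statements about indices, reduced to computation *)

Lemma forall_lt n (P : pred nat) :
  all P (iota 0 n) -> forall i, i < n -> P i.
Proof. by move=> /allP h i lt_in; apply: h; rewrite mem_iota. Qed.

Lemma forall_lt2 n (P : rel nat) :
  all (fun i => all (P i) (iota 0 n)) (iota 0 n) ->
  forall i j, i < n -> j < n -> P i j.
Proof. by move=> h i j /(forall_lt h) hi; apply: forall_lt. Qed.

Lemma forall_lt3 n (P : nat -> rel nat) :
  all (fun i => all (fun j => all (P i j) (iota 0 n)) (iota 0 n)) (iota 0 n) ->
  forall i j k, i < n -> j < n -> k < n -> P i j k.
Proof. by move=> h i j k /(forall_lt h) hi; apply: forall_lt2. Qed.

(** * The ten words *)

(** Closed adjacency in the 6-cycle: [j - i] is 0, 1 or -1 modulo 6. Adding 6 first keeps the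
    subtraction on naturals from truncating. *)
Definition hex_clo (i j : nat) := (j + 6 - i) %% 6 \in [:: 0; 1; 5].
Definition B_clo (j k : nat) := k %% 3 != j %% 3.

Definition Aword i := mkseq (hex_clo i) 6.
Definition Bword j := mkseq (B_clo j) 6.
Definition Awords := mkseq Aword 6.
Definition Bwords := mkseq Bword 3.
Definition words := nseq 6 false :: Awords ++ Bwords.

Lemma eq_nth_mkseq (f g : nat -> bool) n :
  mkseq f n = mkseq g n <-> forall k, k < n -> f k = g k.
Proof.
split=> [e k lt_kn|h].
  by rewrite -(nth_mkseq false f lt_kn) e nth_mkseq.
by apply/eq_in_map => k; rewrite mem_iota => /andP[_ /h].
Qed.

Lemma Aword_in i : i < 6 -> Aword i \in words.
Proof. by move: i; apply: forall_lt; vm_compute. Qed.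

Lemma words_cases s : s \in words ->
  [\/ s = nseq 6 false, exists2 i, i < 6 & s = Aword i
    | exists2 j, j < 3 & s = Bword j].
Proof.
rewrite inE => /orP[/eqP|]; first by constructor 1.
rewrite mem_cat => /orP[] /mapP[i]; rewrite mem_iota => /andP[_ lt_i] ->.
  by constructor 2; exists i.
by constructor 3; exists i.
Qed.

(** Minimum distance two, phrased as the change of a single letter because exchanging one hexagon
    vertex alters at most that letter of a word. *)
Lemma words_distance s k b :
  s \in words -> k < 6 -> set_nth false s k b \in words -> b = nth false s k.
Proof.
have: all (fun s => all (fun k => all (fun b =>
    (set_nth false s k b \in words) ==> (b == nth false s k))
  [:: true; false]) (iota 0 6)) words by vm_compute.
move=> /allP h /h{}h /(forall_lt h)/allP{}h.
have /h : b \in [:: true; false] by case: b.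
by move=> /implyP{}h /h/eqP.
Qed.

Lemma hex_clo_sym i j : i < 6 -> j < 6 -> hex_clo i j = hex_clo j i.
Proof.
by move=> hi hj; apply/eqP; move: i j hi hj; apply: forall_lt2; vm_compute.
Qed.

Lemma hex_clo_rot i j k : i < 6 -> j < 6 -> k < 6 ->
  hex_clo ((i + j) %% 6) ((i + k) %% 6) = hex_clo j k.
Proof.
move=> hi hj hk; apply/eqP.
by move: i j k hi hj hk; apply: forall_lt3; vm_compute.
Qed.

Lemma Aword_inj i j : i < 6 -> j < 6 -> Aword i = Aword j -> i = j.
Proof.
move=> hi hj /eqP e; apply/eqP; apply: implyP e.
by move: i j hi hj; apply: forall_lt2; vm_compute.
Qed.

Lemma Bword_inj i j : i < 3 -> j < 3 -> Bword i = Bword j -> i = j.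
Proof.
move=> hi hj /eqP e; apply/eqP; apply: implyP e.
by move: i j hi hj; apply: forall_lt2; vm_compute.
Qed.

Lemma Aword_neq_Bword i j : i < 6 -> j < 3 -> Aword i != Bword j.
Proof.
(* The bound on [j] is weakened to 6 so that one range serves both indices. *)
move=> hi /ltn_trans/(_ (isT : 3 < 6)) hj; move: i j hi hj.
by apply: forall_lt2; vm_compute.
Qed.

(** * Closed neighbourhoods, hexagons and induced subgraphs *)

Section Neighbourhoods.
Variable G : sgraph.
Implicit Types (u v x y : G) (c : nat -> G).

Definition clo x y := (x == y) || adj x y.

Lemma clo_sym x y : clo x y = clo y x.
Proof. by rewrite /clo eq_sym adj_sym. Qed.

Lemma cloxx x : clo x x.
Proof. by rewrite /clo eqxx. Qed.

Lemma adj_clo x y : adj x y = (x != y) && clo x y.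
Proof. by rewrite /clo; case: eqP => //= ->; rewrite adj_irrefl. Qed.

(** Injectivity comes for free: vertices with the same image have the same neighbours in [H]. This
    serves for the path and the cycle; the leaves of a claw are twins, so the claw is treated
    directly. *)
Lemma induced_twin_free (H : sgraph) (f : H -> G) :
  (forall a b : H, (forall d, adj a d = adj b d) -> a = b) ->
  (forall a b, adj (f a) (f b) = adj a b) -> induced_subgraph H G.
Proof.
move=> tf h; exists f; split=> // a b e.
by apply: tf => d; rewrite -!h e.
Qed.

Lemma claw_induced u x y z :
  adj u x -> adj u y -> adj u z -> ~~ clo x y -> ~~ clo x z -> ~~ clo y z ->
  induced_subgraph claw G.
Proof.
rewrite /clo !negb_or => ux uy uz /andP[xy axy] /andP[xz axz] /andP[yz ayz].
pose leaf := nth u [:: x; y; z].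
have adj_leaf (i : 'I_3) : adj u (leaf i).
  by case: i => -[|[|[|]]].
have leaf_indep (i j : 'I_3) : adj (leaf i) (leaf j) = false.
  by case: i j => -[|[|[|]]] // ? [[|[|[|]]] //= ?]; rewrite /leaf /=
     ?adj_irrefl ?(negbTE axy) ?(negbTE axz) ?(negbTE ayz) // adj_sym
     ?(negbTE axy) ?(negbTE axz) ?(negbTE ayz).
have leaf_inj (i j : 'I_3) : leaf i = leaf j -> i = j.
  have uxyz : uniq [:: x; y; z] by rewrite /= !inE negb_or xy xz yz.
  by move=> /eqP; rewrite nth_uniq // => /eqP/val_inj.
exists (fun w : claw => match w with inl _ => u | inr i => leaf i end).
split=> [[i|i] [j|j]|[i|i] [j|j]] /=.
- by rewrite !ord1.
- by move=> e; have:= adj_leaf j; rewrite -e adj_irrefl.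
- by move=> e; have:= adj_leaf i; rewrite e adj_irrefl.
- by move=> /leaf_inj ->.
- by rewrite adj_irrefl.
- by rewrite adj_leaf.
- by rewrite adj_sym adj_leaf.
- by rewrite leaf_indep.
Qed.

Definition hexagon c := forall i j, i < 6 -> j < 6 ->
  clo (c i) (c j) = hex_clo i j.

Definition word c v := mkseq (fun k => clo v (c k)) 6.

Lemma nth_word c v k : k < 6 -> nth false (word c v) k = clo v (c k).
Proof. exact: nth_mkseq. Qed.

Lemma hexagon_rot c i : i < 6 -> hexagon c ->
  hexagon (fun k => c ((i + k) %% 6)).
Proof.
by move=> hi hc j k hj hk; rewrite hc ?ltn_mod // hex_clo_rot.
Qed.

Lemma word_hexagon c i : hexagon c -> i < 6 -> word c (c i) = Aword i.
Proof. by move=> hc hi; apply/eq_nth_mkseq => k hk; apply: hc. Qed.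

Lemma hexagon_adj c i j : hexagon c -> i < 6 -> j < 6 ->
  adj (c i) (c j) = (i != j) && hex_clo i j.
Proof.
move=> hc hi hj; rewrite adj_clo hc //; congr (~~ _ && _).
(* What is left is injectivity of [c] below 6: equal vertices have equal words, and the six words
   are distinct. *)
apply/eqP/eqP => [e|->] //.
by apply: (@Aword_inj i j) => //; rewrite -!(word_hexagon hc) // e.
Qed.

Lemma hexagon_replace c i x : hexagon c -> i < 6 -> word c x = Aword i ->
  hexagon (fun k => if k == i then x else c k).
Proof.
move=> hc hi /eq_nth_mkseq hx j k hj hk.
case: eqP => [->|_]; case: eqP => [->|_].
- by rewrite cloxx; apply/esym; move: i hi {hx}; apply: forall_lt; vm_compute.
- exact: hx.
- by rewrite clo_sym hx // hex_clo_sym.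
- exact: hc.
Qed.

(** Dropping [c 0] leaves the induced path [v], [c 1], ..., [c 5]. *)
Lemma P6_induced c v : hexagon c ->
  (forall k, k < 6 -> adj v (c k) = (k < 2)) ->
  induced_subgraph (path_graph 6) G.
Proof.
move=> hc hv.
pose p (k : nat) := if k == 0 then v else c k.
pose P6 i j := (j == i.+1) || (i == j.+1).
apply: (@induced_twin_free (path_graph 6) (fun i => p (val i))).
  move=> /= i j h; apply/val_inj/eqP => /=.
  (* Equality of neighbourhoods is moved from ordinals to naturals, where the absence of twins is a
     finite check. *)
  have {}h : all (fun k => P6 i k == P6 j k) (iota 0 6).
    apply/allP => k; rewrite mem_iota => /andP[_ hk].
    by apply/eqP; have := h (Ordinal hk).
  move: h; apply: implyP.
  move: (nat_of_ord i) (nat_of_ord j) (ltn_ord i) (ltn_ord j).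
  by apply: forall_lt2; vm_compute.
move=> i j /=; transitivity (P6 i j) => //; rewrite /p.
move: (nat_of_ord i) (nat_of_ord j) (ltn_ord i) (ltn_ord j) => {}i {}j hi hj.
case: eqP => [->|/eqP i0]; case: eqP => [->|/eqP j0].
- by rewrite adj_irrefl.
- by rewrite hv //; case: j j0 {hj} => [|[|j]].
- by rewrite adj_sym hv //; case: i i0 {hi} => [|[|i]].
rewrite hexagon_adj //; apply/eqP; move: j0; apply: implyP.
move: i0; apply: implyP; move: i j hi hj.
by apply: forall_lt2; vm_compute.
Qed.

(** Dropping [c 1] and [c 2] leaves the induced cycle [v], [c 3], [c 4], [c 5], [c 0]; the shift by
    2 in [e] lists it in this order. *)
Lemma C5_induced c v : hexagon c ->
  (forall k, k < 6 -> adj v (c k) = (k < 4)) ->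
  induced_subgraph (cycle_graph 5) G.
Proof.
move=> hc hv.
pose e k := (k + 2) %% 6.
pose p (k : nat) := if k == 0 then v else c (e k).
pose C5 i j := (i != j) && ((j == i.+1 %% 5) || (i == j.+1 %% 5)).
apply: (@induced_twin_free (cycle_graph 5) (fun i => p (val i))).
  move=> /= i j h; apply/val_inj/eqP => /=.
  have {}h : all (fun k => C5 i k == C5 j k) (iota 0 5).
    apply/allP => k; rewrite mem_iota => /andP[_ hk].
    by apply/eqP; have := h (Ordinal hk).
  move: h; apply: implyP.
  move: (nat_of_ord i) (nat_of_ord j) (ltn_ord i) (ltn_ord j).
  by apply: forall_lt2; vm_compute.
move=> i j /=; transitivity (C5 i j) => //; rewrite /p.
move: (nat_of_ord i) (nat_of_ord j) (ltn_ord i) (ltn_ord j) => {}i {}j hi hj.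
have he k : e k < 6 by rewrite ltn_mod.
case: eqP => [->|/eqP i0]; case: eqP => [->|/eqP j0].
- by rewrite adj_irrefl.
- by rewrite hv //; case: j j0 hj => [|[|[|[|[|]]]]].
- by rewrite adj_sym hv //; case: i i0 hi => [|[|[|[|[|]]]]].
rewrite hexagon_adj //; apply/eqP; move: j0; apply: implyP.
move: i0; apply: implyP; move: i j hi hj.
by apply: forall_lt2; vm_compute.
Qed.

(** * Consequences of the forbidden subgraphs *)

Hypothesis Gfree : free [:: path_graph 6; cycle_graph 5; claw] G.

Lemma P6_free : ~ induced_subgraph (path_graph 6) G.
Proof. by apply: Gfree; left. Qed.

Lemma C5_free : ~ induced_subgraph (cycle_graph 5) G.
Proof. by apply: Gfree; right; left. Qed.

Lemma claw_free u x y z :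
  adj u x -> adj u y -> adj u z -> ~~ clo x y -> ~~ clo x z -> clo y z.
Proof.
move=> ux uy uz xy xz; apply/negPn/negP => yz.
have/Gfree : List.In claw [:: path_graph 6; cycle_graph 5; claw].
  by right; right; left.
by apply; apply: (@claw_induced u x y z).
Qed.

(** The conditions exclude, in turn, an isolated one, three alternate ones, exactly two consecutive
    ones and exactly four. There remain no ones, a run of three, or two runs of two separated by
    opposite zeros. The proof inspects all 64 words. *)
Lemma words_forbidden (b : nat -> bool) :
  (forall i, i < 6 ->
    [/\ b i -> ~~ b ((i + 5) %% 6) -> b ((i + 1) %% 6),
        ~~ [&& b i, b ((i + 2) %% 6) & b ((i + 4) %% 6)],
        mkseq (fun k => b ((i + k) %% 6)) 6 <> mkseq (fun k => k < 2) 6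
      & mkseq (fun k => b ((i + k) %% 6)) 6 <> mkseq (fun k => k < 4) 6]) ->
  mkseq b 6 \in words.
Proof.
move=> h.
move: (h 0 isT) (h 1 isT) (h 2 isT) (h 3 isT) (h 4 isT) (h 5 isT).
rewrite /mkseq /=.
by case: (b 0); case: (b 1); case: (b 2); case: (b 3); case: (b 4);
  case: (b 5) => //= -[a0 b0 c0 d0] [a1 b1 c1 d1] [a2 b2 c2 d2]
    [a3 b3 c3 d3] [a4 b4 c4 d4] [a5 b5 c5 d5] //; exfalso; auto.
Qed.

Lemma word_in c v : hexagon c -> word c v \in words.
Proof.
move=> hc.
have [/hasP[k]|/hasPn vc] := boolP (has (fun k => v == c k) (iota 0 6)).
  rewrite mem_iota => /andP[_ hk] /eqP->.
  by rewrite word_hexagon // Aword_in.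
have vadj k : k < 6 -> clo v (c k) = adj v (c k).
  by move=> hk; rewrite adj_clo vc // mem_iota.
apply: words_forbidden => i hi.
(* Rotating the hexagon to start at [c i] reduces each condition to a fixed position. *)
pose d k := c ((i + k) %% 6).
have hd : hexagon d by apply: hexagon_rot.
have dv k : k < 6 -> clo v (d k) = adj v (d k).
  by move=> _; rewrite vadj ?ltn_mod.
have d0 : c i = d 0 by rewrite /d addn0 modn_small.
rewrite d0 -![c ((i + _) %% 6)]/(d _); split.
- rewrite dv // => v0 v5; apply/negPn/negP => v1.
  have: clo (d 5) (d 1) by apply: (@claw_free (d 0) v) => //;
    rewrite 1?adj_sym ?hexagon_adj.
  by rewrite hd.
- apply/and3P => -[]; rewrite !dv // => v0 v2 v4.
  have: clo (d 2) (d 4) by apply: (@claw_free v (d 0)) => //; rewrite hd.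
  by rewrite hd.
- move=> /eq_nth_mkseq h; apply: P6_free; apply: (P6_induced hd) => k hk.
  by rewrite -(h k hk); apply/esym/dv.
- move=> /eq_nth_mkseq h; apply: C5_free; apply: (C5_induced hd) => k hk.
  by rewrite -(h k hk); apply/esym/dv.
Qed.

Lemma clo_twin c i x y : hexagon c -> i < 6 -> word c x = Aword i ->
  clo y x = clo y (c i).
Proof.
move=> hc hi hx; rewrite -nth_word //; apply: words_distance => //.
  exact: word_in.
(* The altered word is the word of [y] for the hexagon with [x] in place of [c i], hence again one
   of the ten. *)
rewrite (_ : set_nth _ _ _ _ = word (fun k => if k == i then x else c k) y).
  by apply: word_in; apply: hexagon_replace.
apply: (@eq_from_nth _ false).
  by rewrite size_set_nth !size_mkseq; apply/maxn_idPr.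
move=> k; rewrite size_set_nth size_mkseq (maxn_idPr hi) => hk.
by rewrite nth_set_nth /= !nth_word //; case: eqP.
Qed.

Lemma clo_AA c i k x y : hexagon c -> i < 6 -> k < 6 ->
  word c x = Aword i -> word c y = Aword k -> clo x y = hex_clo i k.
Proof.
by move=> hc hi hk /eq_nth_mkseq hx hy; rewrite (clo_twin _ hc hk hy) hx.
Qed.

Lemma clo_AB c i j x y : hexagon c -> i < 6 ->
  word c x = Aword i -> word c y = Bword j -> clo x y = B_clo j i.
Proof.
move=> hc hi hx /eq_nth_mkseq hy.
by rewrite clo_sym (clo_twin _ hc hi hx) hy.
Qed.

Lemma adj_Bword c j x k : hexagon c -> j < 3 -> k < 6 ->
  word c x = Bword j -> adj x (c k) = B_clo j k.
Proof.
move=> hc hj hk hx; rewrite adj_clo; have /eq_nth_mkseq -> // := hx.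
rewrite (_ : x != c k) //; apply: contra (Aword_neq_Bword hk hj) => /eqP e.
by rewrite -hx e word_hexagon.
Qed.

Lemma clo_BB c j k x y : hexagon c -> j < 3 -> k < 3 ->
  word c x = Bword j -> word c y = Bword k -> clo x y = (j == k).
Proof.
move=> hc hj hk hx hy.
(* As [j] is at most 2, the indices [j + 1] and [j + 3] need no reduction modulo 6. *)
have jhex n : n < 4 -> j + n < 6.
  by rewrite ltnS => hn; apply: (leq_add hj hn).
have j6 := jhex 0 isT; rewrite addn0 in j6.
have xj : ~~ clo x (c j).
  by have /eq_nth_mkseq -> // := hx; rewrite /B_clo eqxx.
case: eqP => [jk|/eqP jk].
  rewrite -jk in hy.
  have yj : ~~ clo y (c j).
    by have /eq_nth_mkseq -> // := hy; rewrite /B_clo eqxx.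
  (* If [x] and [y] were distinct and nonadjacent, [c (j + 1)] would centre a claw with leaves
     [c j], [x], [y]. *)
  apply: (@claw_free (c (j + 1)) (c j)); rewrite 1?clo_sym //;
    rewrite ?(hexagon_adj hc) ?jhex // 1?adj_sym ?(adj_Bword hc hj _ hx)
      ?(adj_Bword hc hj _ hy) ?jhex //;
    by move: j hj {hx hy jhex j6 xj jk yj}; apply: forall_lt; vm_compute.
apply/negbTE/negP => xy.
have nxy : x != y.
  apply: contra jk => /eqP e; apply/eqP/Bword_inj => //.
  by rewrite -hx e hy.
(* Were [x] and [y] adjacent, [y] would centre a claw with leaves [x], [c j], [c (j + 3)]: both
   hexagon vertices are seen by [y], missed by [x], and opposite each other. *)
have: clo (c j) (c (j + 3)).
  apply: (@claw_free y x) => //.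
  - by rewrite adj_sym adj_clo nxy.
  - by rewrite (adj_Bword hc hk) // /B_clo !modn_small.
  - rewrite (adj_Bword hc hk) ?jhex // /B_clo modnDr.
    by rewrite !modn_small.
  - have /eq_nth_mkseq -> := hx; last exact: jhex.
    by rewrite /B_clo modnDr eqxx.
rewrite hc ?jhex //; apply/negP.
by move: j hj {hx jhex j6 xj jk}; apply: forall_lt; vm_compute.
Qed.

(** By connectedness it suffices that no edge joins a vertex [x] with nonzero word to a vertex [y]
    with zero word. *)
Lemma word_neq0 c v : hexagon c -> connected_graph G ->
  word c v != nseq 6 false.
Proof.
move=> hc Gconn.
pose a := [pred x | word c x != nseq 6 false].
suff cl : closed (@adj G) a.
  have := closed_connect cl (Gconn (c 0) v).
  by rewrite !inE word_hexagon.
apply: intro_closed => [|x y xy]; first exact: sym_connect_sym (@adj_sym G).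
rewrite !inE => hx; apply/negP => /eqP y0.
have {}y0 k : k < 6 -> clo y (c k) = false.
  by move=> hk; rewrite -nth_word // y0 nth_nseq if_same.
(* Here [x] is not itself on the hexagon, since its neighbour [y] sees no hexagon vertex. *)
have xadj k : k < 6 -> nth false (word c x) k -> adj x (c k).
  move=> hk; rewrite nth_word // adj_clo => ->; rewrite andbT.
  by apply/eqP => e; have := y0 k hk; rewrite clo_sym /clo -e xy orbT.
(* Every nonzero word has ones at two nonadjacent places [k], [l], so [y], [c k], [c l] would be the
   leaves of a claw at [x]. *)
have : all (fun s => (s == nseq 6 false) || has (fun k => has (fun l =>
    [&& nth false s k, nth false s l & ~~ hex_clo k l])
  (iota 0 6)) (iota 0 6)) words by vm_compute.
move=> /allP/(_ _ (word_in x hc)); rewrite (negbTE hx) => /hasP[k].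
rewrite mem_iota => hk /hasP[l]; rewrite mem_iota => hl /and3P[xk xl].
rewrite -hc // => /negP; apply.
by apply: (@claw_free x y); rewrite ?xadj ?y0.
Qed.

End Neighbourhoods.

(** * Assembling the partition *)

Lemma hexagon_of_C6 (G : sgraph) :
  induced_subgraph (cycle_graph 6) G -> exists c : nat -> G, hexagon c.
Proof.
move=> [f [finj fadj]]; exists (fun n => f (inord n)) => i j hi hj.
rewrite /clo (inj_eq finj) fadj /= /cycle_adj -!val_eqE /= !inordK //.
by apply/eqP; move: i j hi hj; apply: forall_lt2; vm_compute.
Qed.

Theorem theorem2p9 (G : sgraph)
    (Gconn : connected_graph G)
    (Gfree : free [:: path_graph 6; cycle_graph 5; claw] G)
    (GC6 : induced_subgraph (cycle_graph 6) G) :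
  exists (A : 'I_6 -> {set G}) (B : 'I_3 -> {set G}),
    [/\ partition_family (family_sum A B),
        forall i : 'I_6, A i != set0
      & forall x y : G, x != y ->
          (adj x y <->
           [\/ (exists i : 'I_6, x \in A i /\ y \in A i) \/
               (exists j : 'I_3, x \in B j /\ y \in B j),
               exists i : 'I_6, one_in_each (A i) (A (ordS i)) x y
             | exists (i : 'I_6) (j : 'I_3),
                 i != j %[mod 3] /\ one_in_each (A i) (B j) x y])].
Proof.
have [c hc] := hexagon_of_C6 GC6.
pose A (i : 'I_6) := [set x | word c x == Aword i].
pose B (j : 'I_3) := [set x | word c x == Bword j].
have inA (i : 'I_6) x : reflect (word c x = Aword i) (x \in A i).
  by rewrite inE; apply: eqP.
have inB (j : 'I_3) x : reflect (word c x = Bword j) (x \in B j).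
  by rewrite inE; apply: eqP.
have AA i k x y : x \in A i -> y \in A k -> clo x y = hex_clo i k.
  by move=> /inA hx /inA; apply: (clo_AA Gfree hc).
have AB i j x y : x \in A i -> y \in B j -> clo x y = (i != j %[mod 3]).
  by move=> /inA hx /inB; apply: (clo_AB Gfree hc).
have BB j k x y : x \in B j -> y \in B k -> clo x y = (j == k).
  move=> /inB hx /inB; rewrite -val_eqE.
  by apply: (clo_BB Gfree hc (ltn_ord j) (ltn_ord k)).
have cover x : (exists i, x \in A i) \/ (exists j, x \in B j).
  have [e|[i hi e]|[j hj e]] := words_cases (word_in Gfree x hc).
  - by have := word_neq0 Gfree x hc Gconn; rewrite e eqxx.
  - by left; exists (Ordinal hi); apply/inA.
  - by right; exists (Ordinal hj); apply/inB.
exists A, B; split.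
- split.
    apply/setP => x; rewrite inE; apply/bigcupP.
    by have [[i xi]|[j xj]] := cover x; [exists (inl i)|exists (inr j)].
  (* A common vertex of two parts would have two of the pairwise distinct words. *)
  move=> s t; apply: contraR => /pred0Pn[x /andP[]] /=.
  case: s t => [i|j] [k|l] /=.
  + by move=> /inA e /inA; rewrite e => /Aword_inj h; rewrite (val_inj (h _ _)).
  + by move=> /inA e /inB/eqP; rewrite e (negbTE (Aword_neq_Bword _ _)).
  + by move=> /inB e /inA/esym/eqP; rewrite e (negbTE (Aword_neq_Bword _ _)).
  + by move=> /inB e /inB; rewrite e => /Bword_inj h; rewrite (val_inj (h _ _)).
- by move=> i; apply/set0Pn; exists (c i); apply/inA/word_hexagon.
have hexS (i : 'I_6) : hex_clo i (ordS i).
  suff: hex_clo i (i.+1 %% 6) by [].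
  by move: (nat_of_ord i) (ltn_ord i); apply: forall_lt; vm_compute.
(* The differences 0, 1 and 5 become the same part, the next part and the previous part. *)
have hex_cases (i k : 'I_6) :
    hex_clo i k -> [\/ i = k, k = ordS i | i = ordS k].
  have : hex_clo i k ==>
      [|| i == k :> nat, k == i.+1 %% 6 :> nat | i == k.+1 %% 6 :> nat].
    move: (nat_of_ord i) (nat_of_ord k) (ltn_ord i) (ltn_ord k).
    by apply: forall_lt2; vm_compute.
  by move=> /implyP h /h/or3P[] /eqP e;
    [constructor 1|constructor 2|constructor 3]; apply: val_inj.
move=> x y xy; rewrite adj_clo xy /=; split.
  case: (cover x) (cover y) => [[i xi]|[j xj]] [[k yk]|[l yl]].
  - rewrite (AA i k) // => /hex_cases[e|e|e]; rewrite ?e in xi yk.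
    + by constructor 1; left; exists k.
    + by constructor 2; exists i; left.
    + by constructor 2; exists k; right.
  - rewrite (AB i l) // => h.
    by constructor 3; exists i, l; split=> //; left.
  - rewrite clo_sym (AB k j) // => h.
    by constructor 3; exists k, j; split=> //; right.
  - by rewrite (BB j l) // => /eqP e; constructor 1; right; exists l;
      rewrite -{1}e.
case=> [[[i [xi yi]]|[j [xj yj]]]|[i [[xi yi]|[xi yi]]]
  |[i [j [h [[xi yi]|[xi yi]]]]]].
- by rewrite (AA i i) //; move: (nat_of_ord i) (ltn_ord i); apply: forall_lt;
    vm_compute.
- by rewrite (BB j j).
- by rewrite (AA i (ordS i)).
- by rewrite clo_sym (AA i (ordS i)).
- by rewrite (AB i j).
- by rewrite clo_sym (AB i j).
Qed.
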